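(* Let $A_n,B_n\subseteq\Theta_n$ be disjoint non-random sets, let $t_n>0$, let $F_n=\frac{\Pi_n(B_n\mid X^n)}{\Pi_n(A_n\mid X^n)}$, and let $\theta\in\Theta_n$. If $P_\theta\Pi_n(A_n\mid X^n)\ge1-a_n$ with $0<a_n<1$, then $$P_\theta(F_n>t_n)\le2a_n\left(1+\frac1{t_n}\right).$$ If, in addition, $P_\theta\Pi_n(B_n\mid X^n)\le b_n$, then $$P_\theta(F_n>t_n)\le2a_n+\frac{2b_n}{t_n}.$$
   Context: Parameter space: for an integer $0\le m<n/2$, $\Theta_{n,m}=\{\theta\in\{0,1\}^n:\sum_{i=1}^n\theta_i=m\}$; if $n$ is even, $\Theta_{n,n/2}=\{\theta\in\{0,1\}^n:\sum_{i=1}^n\theta_i=n/2,\ \theta_1=0\}$; and $\Theta_n=\bigcup_{m=0}^{\lfloor n/2\rfloor}\Theta_{n,m}$. Model (planted bi-section model): $p_n,q_n\in(0,1)$. $X^n$ is a random undirected graph without loops on vertex set $\{1,\ldots,n\}$, with edge indicators $X_{ij}\in\{0,1\}$, $i<j$. Under $P_\theta$, $\theta\in\Theta_n$, the $X_{ij}$ ($i<j$) are independent with $P_\theta(X_{ij}=1)=Q_{i,j}(\theta)$, where $Q_{i,j}(\theta)=p_n$ if $\theta_i=\theta_j$ and $Q_{i,j}(\theta)=q_n$ if $\theta_i\ne\theta_j$. The likelihood is $p_\theta(X^n)=\prod_{i<j}Q_{i,j}(\theta)^{X_{ij}}(1-Q_{i,j}(\theta))^{1-X_{ij}}$. Posterior: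 the prior is a probability mass function $\pi_n$ on $\Theta_n$ with $\pi_n(\eta)>0$ for all $\eta\in\Theta_n$, and for $S\subseteq\Theta_n$, $\Pi_n(S\mid X^n)=\sum_{\theta\in S}\pi_n(\theta)p_\theta(X^n)\big/\sum_{\theta\in\Theta_n}\pi_n(\theta)p_\theta(X^n)$. For a real-valued function $f$ of $X^n$, $P_\theta f(X^n)$ denotes its expectation when $X^n\sim P_\theta$. *)

(* Defs.v *)
From HB Require Import structures.
From mathcomp Require Import all_boot all_order all_algebra.
From mathcomp Require Import reals.

Set Implicit Arguments.
Unset Strict Implicit.
Unset Printing Implicit Defensive.

Import Order.TTheory GRing.Theory Num.Theory.
Local Open Scope ring_scope.

(** Vertices are ['I_n], so vertex [i] of {1, ..., n} has value [i - 1]. *)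

Definition labels (n : nat) : finType := {ffun 'I_n -> bool}.

(** [Theta_m n m] is only meant for [m <= n./2]; the condition theta_1 = 0
    applies exactly when [n] is even and [m = n / 2]. *)
Definition Theta_m (n m : nat) : {set labels n} :=
  [set theta : labels n |
    (\sum_(i < n) (theta i : nat) == m)%N &&
    ((m.*2 == n) ==>
       [forall i : 'I_n, (val i == 0)%N ==> (theta i == false)])].

Definition Theta (n : nat) : {set labels n} :=
  \bigcup_(m < n./2.+1) Theta_m n m.

(** Unordered pairs of distinct vertices, as pairs (i, j) with i < j. *)
Definition edge (n : nat) : finType :=
  {e : 'I_n * 'I_n | (e.1 < e.2)%N}.

(** A loopless undirected graph is given by its edge indicators X_ij, i < j. *)
Definition graph (n : nat) : finType := {ffun edge n -> bool}.

Section Model.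
Variables (R : realType) (n : nat) (p q : R).

Definition edge_prob (theta : labels n) (e : edge n) : R :=
  if theta (val e).1 == theta (val e).2 then p else q.

Definition likelihood (theta : labels n) (X : graph n) : R :=
  \prod_(e : edge n)
    (edge_prob theta e ^+ (X e : nat) *
     (1 - edge_prob theta e) ^+ (1 - (X e : nat))%N).

(** P_theta is the law on the finite sample space of graphs whose probability
    mass function is the likelihood; see [Pr_graphT] and [Pr_graph_indep]. *)
Definition Pr_graph (theta : labels n) (E : pred (graph n)) : R :=
  \sum_(X : graph n | E X) likelihood theta X.

Definition Ex_graph (theta : labels n) (f : graph n -> R) : R :=
  \sum_(X : graph n) likelihood theta X * f X.

Definition is_prior (prior : labels n -> R) : Prop :=
  (forall eta, eta \in Theta n -> 0 < prior eta) /\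
  \sum_(eta in Theta n) prior eta = 1.

Definition posterior (prior : labels n -> R) (S : {set labels n})
    (X : graph n) : R :=
  (\sum_(theta in S) prior theta * likelihood theta X) /
  (\sum_(theta in Theta n) prior theta * likelihood theta X).

Lemma Pr_graph_indep (theta : labels n) (J : {set edge n}) :
  Pr_graph theta (fun X => [forall e in J, X e]) =
  \prod_(e in J) edge_prob theta e.
Proof.
pose g e (b : bool) : R := edge_prob theta e ^+ (b : nat) *
  (1 - edge_prob theta e) ^+ (1 - (b : nat))%N.
pose h e (b : bool) : R := if (e \in J) ==> b then g e b else 0.
transitivity (\sum_(X : graph n) \prod_(e : edge n) h e (X e)).
  rewrite /Pr_graph big_mkcond /=; apply: eq_bigr => X _.
  case: ifPn => [/forallP XJ | /forallPn [e XeF]].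
    by apply: eq_bigr => e _; rewrite /h (XJ e).
  by rewrite (bigD1 e) //= /h (negbTE XeF) mul0r.
rewrite -(bigA_distr_bigA h) [RHS]big_mkcond; apply: eq_bigr => e _.
rewrite big_bool /h /g /=; case: (e \in J) => /=.
  by rewrite addr0 expr1 expr0 mulr1.
by rewrite !expr1 !expr0 mulr1 mul1r addrC subrK.
Qed.

Lemma Pr_graphT (theta : labels n) : Pr_graph theta predT = 1.
Proof.
rewrite -[RHS](big_set0 1 *%R (edge_prob theta)) -Pr_graph_indep.
by apply: eq_bigl => X; apply/esym/forallP => e; rewrite in_set0.
Qed.

End Model.

(* Main.v *)
Require Import Defs.
From HB Require Import structures.
From mathcomp Require Import all_boot all_order all_algebra.
From mathcomp Require Import reals.
From mathcomp Require Import ring lra.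

Import Order.TTheory GRing.Theory Num.Theory.
Local Open Scope ring_scope.

(** Write x and y for the posterior masses of A and B at a given graph.  If
    y / x > t, then either x <= 1/2, whence 1 <= 2 (1 - x), or x > 1/2, whence
    y > t x > t / 2 and 1 <= 2 y / t.  So the indicator of the event F > t is
    at most 2 (1 - x) + 2 y / t at every graph ([indicator_ratio_le]), and
    integrating this against P_theta gives 2 a + 2 b / t
    ([Pr_graph_ratio_le]).

    The first bound is the second one with b = a: since A and B are disjoint,
    x + y <= 1 at every graph ([posterior_disjoint_le1]), so the expectation
    of y is at most one minus that of x, hence at most a. *)

(** The threshold [1/2] on [x] serves two purposes: below it the first term is
    already at least [1], which takes care of [x = 0], and above it the
    quotient can be cleared at the cost of a factor [2]. *)
Lemma indicator_ratio_le (R : realFieldType) (t x y : R) :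
  0 < t -> x <= 1 -> 0 <= y ->
  ((t < y / x)%R : nat)%:R <= 2 * (1 - x) + 2 * y / t.
Proof.
move=> t0 x1 y0.
have yt0 : 0 <= y / t by rewrite divr_ge0 // ltW.
rewrite -mulrA; case: ltP => [txy|_] /=; last by lra.
case: (lerP x (1 / 2)) => hx; first by lra.
suff : 1 / 2 <= y / t by lra.
have x0 : 0 < x by lra.
move: txy; rewrite ltr_pdivlMr // => txy.
by rewrite ler_pdivlMr //; nra.
Qed.

Section Model.
Context {R : realType} {n : nat} {p q : R}.
Hypotheses (hp : 0 < p < 1) (hq : 0 < q < 1).

Lemma likelihood_ge0 theta (X : graph n) : 0 <= likelihood p q theta X.
Proof.
have [/andP[p0 p1] /andP[q0 q1]] := (hp, hq).
apply: prodr_ge0 => e _; rewrite mulr_ge0 ?exprn_ge0 // /edge_prob;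
  by case: ifP => _; lra.
Qed.

Lemma Ex_graph_le theta (f g : graph n -> R) :
  (forall X, f X <= g X) -> Ex_graph p q theta f <= Ex_graph p q theta g.
Proof.
by move=> fg; apply: ler_sum => X _; rewrite ler_wpM2l ?likelihood_ge0.
Qed.

Lemma Ex_graph_cst (theta : labels n) (c : R) : Ex_graph p q theta (fun=> c) = c.
Proof. by rewrite /Ex_graph -mulr_suml -[RHS]mul1r -(Pr_graphT p q theta). Qed.

Lemma Ex_graphD theta (f g : graph n -> R) :
  Ex_graph p q theta (fun X => f X + g X) =
  Ex_graph p q theta f + Ex_graph p q theta g.
Proof. by rewrite -big_split; apply: eq_bigr => X _; rewrite mulrDr. Qed.

Lemma Ex_graphZ theta (c : R) (f : graph n -> R) :
  Ex_graph p q theta (fun X => c * f X) = c * Ex_graph p q theta f.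
Proof.
by rewrite /Ex_graph mulr_sumr; apply: eq_bigr => X _; rewrite mulrCA.
Qed.

Lemma Pr_graphE theta (E : pred (graph n)) :
  Pr_graph p q theta E = Ex_graph p q theta (fun X => (E X : nat)%:R).
Proof.
rewrite /Pr_graph big_mkcond; apply: eq_bigr => X _.
by case: (E X); rewrite ?mulr1 ?mulr0.
Qed.

Lemma Pr_graph_ratio_le theta (x y : graph n -> R) (t : R) :
  0 < t -> (forall X, x X <= 1) -> (forall X, 0 <= y X) ->
  Pr_graph p q theta (fun X => t < y X / x X) <=
  2 * (1 - Ex_graph p q theta x) + 2 * Ex_graph p q theta y / t.
Proof.
move=> t0 x1 y0.
have -> : 2 * (1 - Ex_graph p q theta x) + 2 * Ex_graph p q theta y / t =
    Ex_graph p q theta (fun X => (2 + (-2) * x X) + (2 / t) * y X).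
  by rewrite !Ex_graphD !Ex_graphZ Ex_graph_cst; ring.
rewrite Pr_graphE; apply: Ex_graph_le => X.
apply: le_trans (indicator_ratio_le _ _ _ _ t0 (x1 X) (y0 X)) _.
by rewrite le_eqVlt; apply/orP; left; apply/eqP; ring.
Qed.

Section Posterior.
Variable prior : labels n -> R.
Hypothesis prior_ge0 : forall eta, eta \in Theta n -> 0 <= prior eta.

Let weight_ge0 (X : graph n) eta :
  eta \in Theta n -> 0 <= prior eta * likelihood p q eta X.
Proof. by move=> /prior_ge0 ?; rewrite mulr_ge0 ?likelihood_ge0. Qed.

Lemma posterior_ge0 (S : {set labels n}) X :
  S \subset Theta n -> 0 <= posterior p q prior S X.
Proof.
move=> /subsetP ST; apply: divr_ge0; apply: sumr_ge0 => eta.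
  by move=> /ST; apply: weight_ge0.
exact: weight_ge0.
Qed.

Lemma posteriorU (A B : {set labels n}) X : [disjoint A & B] ->
  posterior p q prior (A :|: B) X =
  posterior p q prior A X + posterior p q prior B X.
Proof.
by move=> AB; rewrite /posterior -mulrDl -bigU //; congr (_ / _);
  apply: eq_bigl => eta; rewrite !inE.
Qed.

Lemma posterior_le1 (S : {set labels n}) X :
  S \subset Theta n -> posterior p q prior S X <= 1.
Proof.
move=> ST; rewrite /posterior; set D := \sum_(_ in Theta n) _.
have : 0 <= D by apply: sumr_ge0 => eta; apply: weight_ge0.
(* Where the normalising sum vanishes, the quotient is 0. *)
rewrite le_eqVlt => /predU1P[<-|D0]; first by rewrite invr0 mulr0.
rewrite ler_pdivrMr // mul1r /D [leRHS](big_setID S) /= (setIidPr ST) lerDl.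
by apply: sumr_ge0 => eta /setDP[+ _]; apply: weight_ge0.
Qed.

Lemma posterior_disjoint_le1 (A B : {set labels n}) X :
  A \subset Theta n -> B \subset Theta n -> [disjoint A & B] ->
  posterior p q prior A X + posterior p q prior B X <= 1.
Proof.
by move=> AT BT AB; rewrite -posteriorU // posterior_le1 // subUset AT.
Qed.

End Posterior.
End Model.

Theorem theorem6p1 (R : realType) (n : nat) (p q : R)
    (hp : 0 < p < 1) (hq : 0 < q < 1)
    (prior : labels n -> R) (hprior : is_prior prior)
    (A B : {set labels n}) (hA : A \subset Theta n) (hB : B \subset Theta n)
    (hAB : [disjoint A & B])
    (t : R) (ht : 0 < t)
    (theta : labels n) (htheta : theta \in Theta n)
    (a : R) (ha : 0 < a < 1)
    (hPA : Ex_graph p q theta (posterior p q prior A) >= 1 - a) :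
  let F := fun X : graph n =>
    posterior p q prior B X / posterior p q prior A X in
  Pr_graph p q theta (fun X => F X > t) <= 2 * a * (1 + 1 / t) /\
  (forall b : R,
     Ex_graph p q theta (posterior p q prior B) <= b ->
     Pr_graph p q theta (fun X => F X > t) <= 2 * a + 2 * b / t).
Proof.
move=> F.
have prior_ge0 eta : eta \in Theta n -> 0 <= prior eta.
  by move=> /hprior.1 /ltW.
have bound b : Ex_graph p q theta (posterior p q prior B) <= b ->
    Pr_graph p q theta (fun X => F X > t) <= 2 * a + 2 * b / t.
  move=> hPB.
  apply: le_trans (Pr_graph_ratio_le hp hq theta _ _ _ ht _ _) _ => [X|X|].
  - exact: posterior_le1.
  - exact: posterior_ge0.
  - by apply: lerD; [lra | rewrite ler_pM2r ?invr_gt0 // ler_pM2l].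
split=> //.
have -> : 2 * a * (1 + 1 / t) = 2 * a + 2 * a / t by ring.
apply: bound.
have : Ex_graph p q theta (fun X => posterior p q prior A X +
    posterior p q prior B X) <= Ex_graph p q theta (fun=> 1).
  by apply: Ex_graph_le => // X; apply: posterior_disjoint_le1.
by rewrite Ex_graphD Ex_graph_cst; lra.
Qed.
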